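(* Let $p$ be a prime, let $n>1$ be an integer, and let $G$ be an extraspecial group of order $p^{2n+1}$. Then $G$ is an F-group which is not a CA-group.
   Context: $C_G(x)$ denotes the centraliser of $x$ in $G$ and $Z(G)$ the centre of $G$. A finite group $G$ is a CA-group if $C_G(x)$ is abelian for every non-central element $x\in G$. A finite group $G$ is an F-group if the centraliser of a non-central element never properly contains the centraliser of another non-central element; that is, there are no $x,y\in G\setminus Z(G)$ with $C_G(x)<C_G(y)$ (proper containment). *)

(* Defs.v *)
From mathcomp Require Import all_boot all_fingroup all_solvable.
Set Implicit Arguments.
Unset Strict Implicit.
Unset Printing Implicit Defensive.
Import GroupScope.

Definition CA_group (gT : finGroupType) (G : {group gT}) : Prop :=
  forall x, x \in G :\: 'Z(G) -> abelian 'C_G[x].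

Definition F_group (gT : finGroupType) (G : {group gT}) : Prop :=
  ~ exists x y, [/\ x \in G :\: 'Z(G), y \in G :\: 'Z(G)
                  & 'C_G[x] \proper 'C_G[y]].

(* Main.v *)
Require Import Defs.
From mathcomp Require Import all_boot all_fingroup all_solvable.
Import GroupScope.

(* Centralisers of non-central elements are maximal, so none properly contains
   another. Such a centraliser C has index p, hence |'C_G(C)| = p * |'Z(G) :&: C|
   is at most p ^ 2; an abelian C would lie in 'C_G(C), forcing |G| <= p ^ 3. *)

Lemma extraspecial_F_group (gT : finGroupType) (G : {group gT}) :
  extraspecial G -> F_group G.
Proof.
move=> esG [x [y [/setDP[Gx Zx] /setDP[Gy Zy] ltC]]].
have /maxgroupP[_ maxCx] := cent1_extraspecial_maximal esG Gx Zx.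
have /maxgroupp ltCyG := cent1_extraspecial_maximal esG Gy Zy.
(* ['C_G[y]] is proper in [G] and contains the maximal ['C_G[x]], so the two coincide. *)
by have := maxCx _ ltCyG (proper_sub ltC) => eqC; rewrite eqC properxx in ltC.
Qed.

Lemma card_extraspecial_abelian_cent1 (p : nat) (gT : finGroupType)
    (G : {group gT}) (x : gT) :
    p.-group G -> extraspecial G -> x \in G :\: 'Z(G) -> abelian 'C_G[x] ->
  #|G| <= p ^ 3.
Proof.
move=> pG esG /setDP[Gx Zx] abC.
have sCG : 'C_G[x] \subset G := subsetIl _ _.
have iC : #|G : 'C_G[x]| = p.
  exact: p_maximal_index pG (cent1_extraspecial_maximal esG Gx Zx).
have leC : #|'C_G[x]| <= p * p.
  have sCC : 'C_G[x] \subset 'C_G('C_G[x]) by rewrite subsetI sCG.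
  apply: leq_trans (subset_leq_card sCC) _.
  rewrite (card_subcent_extraspecial pG esG sCG) iC leq_mul //.
  (* The factor ['Z(G) :&: 'C_G[x]] sits inside the centre, which has order [p]. *)
  by rewrite -(card_center_extraspecial pG esG) subset_leq_card ?subsetIl.
by rewrite -(Lagrange sCG) iC !expnSr expn0 mul1n leq_mul.
Qed.

Theorem proposition1p3 (p n : nat) (gT : finGroupType) (G : {group gT})
    (p_prime : prime p) (n_gt1 : (1 < n)%N)
    (esG : extraspecial G) (oG : #|G| = (p ^ (2 * n + 1))%N) :
  F_group G /\ ~ CA_group G.
Proof.
have pG : p.-group G by rewrite /pgroup oG pnatX pnat_id.
split=> [|caG]; first exact: extraspecial_F_group esG.
(* ['Z(G)] unfolds to [G :&: 'C(G)], so this inclusion would make [G] abelian. *)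
have /subsetPn[x Gx Zx] : ~~ (G \subset 'Z(G)).
  by rewrite subsetI subxx extraspecial_nonabelian.
have Gx' : x \in G :\: 'Z(G) by apply/setDP.
have := card_extraspecial_abelian_cent1 _ _ _ _ pG esG Gx' (caG x Gx').
rewrite oG leq_exp2l ?prime_gt1 // addn1 ltnS leqNgt.
(* What is left is [2 * n <= 2]; reading the right-hand [2] as [2 * 1] lets the factor cancel
   against [1 < n]. *)
by rewrite (@ltn_pmul2l 2 1 n) // n_gt1.
Qed.
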